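(* For $n\ge1$, the Artin group $A_{A_n}$ of type $A_n$ is locally indicable if and only if $n=1,2$ or $3$.
   Context: $A_{A_n}$ ($n\ge1$) is the group with generators $a_1,\dots,a_n$ and relations $a_ia_j=a_ja_i$ for $|i-j|\ge2$, $a_ia_{i+1}a_i=a_{i+1}a_ia_{i+1}$ for $1\le i\le n-1$ (the braid group on $n+1$ strings). A group $G$ is locally indicable if every nontrivial finitely generated subgroup $H$ of $G$ admits a nontrivial homomorphism $H\to\mathbb{Z}$. *)

(* Defs.v *)
From HB Require Import structures.
From mathcomp Require Import all_boot all_order all_algebra.
From mathcomp Require Import boolp.

Set Implicit Arguments.
Unset Strict Implicit.
Unset Printing Implicit Defensive.

Local Open Scope group_scope.
Local Open Scope quotient_scope.

(* The letter (x, false) stands for the generator x, (x, true) for x^-1. *)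
Definition word (X : Type) : Type := seq (X * bool).

HB.instance Definition _ (X : choiceType) := Choice.on (word X).

Definition invw (X : Type) (u : word X) : word X :=
  rev [seq (l.1, ~~ l.2) | l <- u].

(* R u v is the relation u = v of the presentation; presEq R is the smallest
   congruence on words that contains these relations and free cancellation. *)
Inductive presEq (X : Type) (R : word X -> word X -> Prop) :
    word X -> word X -> Prop :=
| presEq_refl u : presEq R u u
| presEq_sym u v : presEq R u v -> presEq R v u
| presEq_trans v u w : presEq R u v -> presEq R v w -> presEq R u w
| presEq_cat u u' v v' :
    presEq R u u' -> presEq R v v' -> presEq R (u ++ v) (u' ++ v')
| presEq_cancel x b : presEq R [:: (x, b); (x, ~~ b)] [::]
| presEq_rel u v : R u v -> presEq R u v.

Definition presEqb (X : choiceType) (R : word X -> word X -> Prop) :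
  rel (word X) := fun u v => `[< presEq R u v >].

Lemma presEqb_equiv (X : choiceType) (R : word X -> word X -> Prop) :
  equiv_class_of (presEqb R).
Proof.
split=> [u|u v|v u w].
- exact/asboolP/presEq_refl.
- by apply/asboolP/asboolP; apply: presEq_sym.
- by move=> /asboolP uv /asboolP vw; apply/asboolP; apply: presEq_trans uv vw.
Qed.

Canonical presEqb_equivRel (X : choiceType) (R : word X -> word X -> Prop) :=
  EquivRelPack (presEqb_equiv R).

Definition presented (X : choiceType) (R : word X -> word X -> Prop) :=
  {eq_quot (presEqb R)}.

HB.instance Definition _ (X : choiceType) (R : word X -> word X -> Prop) :
  EqQuotient _ (presEqb R) (presented R) :=
  EqQuotient.on (presented R).
HB.instance Definition _ (X : choiceType) (R : word X -> word X -> Prop) :=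
  Choice.on (presented R).

Definition presOne (X : choiceType) (R : word X -> word X -> Prop) :
  presented R := \pi_(presented R) [::].
Definition presMul (X : choiceType) (R : word X -> word X -> Prop)
  (a b : presented R) : presented R := \pi_(presented R) (repr a ++ repr b).
Definition presInv (X : choiceType) (R : word X -> word X -> Prop)
  (a : presented R) : presented R := \pi_(presented R) (invw (repr a)).

Lemma pres_piP (X : choiceType) (R : word X -> word X -> Prop) (u v : word X) :
  \pi_(presented R) u = \pi_(presented R) v <-> presEq R u v.
Proof.
split=> [/eqmodP/asboolP //|uv]; apply/eqmodP; exact/asboolP.
Qed.

Lemma pres_reprP (X : choiceType) (R : word X -> word X -> Prop) (u : word X) :
  presEq R (repr (\pi_(presented R) u)) u.
Proof. by apply/pres_piP; rewrite reprK. Qed.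

Lemma presMul_pi (X : choiceType) (R : word X -> word X -> Prop) (u v : word X) :
  presMul (\pi_(presented R) u) (\pi_(presented R) v) =
  \pi_(presented R) (u ++ v).
Proof. by apply/pres_piP/presEq_cat; apply: pres_reprP. Qed.

Lemma presEq_invw (X : Type) (R : word X -> word X -> Prop) (u : word X) :
  presEq R (invw u ++ u) [::].
Proof.
elim: u => [|[x b] u IHu]; first exact: presEq_refl.
rewrite /invw /= rev_cons -cats1 -catA /=.
apply: presEq_trans IHu; apply: presEq_cat; first exact: presEq_refl.
apply: (@presEq_cat _ _ [:: (x, ~~ b); (x, b)] [::] u u); last exact: presEq_refl.
by have := presEq_cancel R x (~~ b); rewrite negbK.
Qed.

Lemma invwK (X : Type) : involutive (@invw X).
Proof.
move=> u; rewrite /invw map_rev revK -map_comp -[RHS]map_id.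
by apply: eq_map => -[x b] /=; rewrite negbK.
Qed.

Lemma presMulA (X : choiceType) (R : word X -> word X -> Prop) :
  associative (@presMul X R).
Proof.
elim/quotW=> u; elim/quotW=> v; elim/quotW=> w.
rewrite (presMul_pi R v w) (presMul_pi R u (v ++ w)).
by rewrite (presMul_pi R u v) (presMul_pi R (u ++ v) w) catA.
Qed.

Lemma presMul1 (X : choiceType) (R : word X -> word X -> Prop) :
  left_id (presOne R) (@presMul X R).
Proof. by elim/quotW=> u; rewrite presMul_pi. Qed.

Lemma presMulr1 (X : choiceType) (R : word X -> word X -> Prop) :
  right_id (presOne R) (@presMul X R).
Proof. by elim/quotW=> u; rewrite presMul_pi cats0. Qed.

Lemma presMulV (X : choiceType) (R : word X -> word X -> Prop) :
  left_inverse (presOne R) (@presInv X R) (@presMul X R).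
Proof.
move=> a; rewrite -[X in presMul _ X]reprK presMul_pi.
exact/pres_piP/presEq_invw.
Qed.

Lemma presMulrV (X : choiceType) (R : word X -> word X -> Prop) :
  right_inverse (presOne R) (@presInv X R) (@presMul X R).
Proof.
move=> a; rewrite -[X in presMul X _]reprK presMul_pi.
by apply/pres_piP; rewrite -{1}[repr a]invwK; apply: presEq_invw.
Qed.

HB.instance Definition _ (X : choiceType) (R : word X -> word X -> Prop) :=
  isGroup.Build (presented R) (@presMulA X R) (@presMul1 X R) (@presMulr1 X R)
    (@presMulV X R) (@presMulrV X R).

(* The generators a_1, ..., a_n are indexed from 0 by 'I_n; in the braid
   relation j is i + 1, so that i and i + 1 are both valid indices. *)
Inductive artinArel (n : nat) : word 'I_n -> word 'I_n -> Prop :=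
| artinA_comm (i j : 'I_n) : (i.+2 <= j) || (j.+2 <= i) ->
    artinArel [:: (i, false); (j, false)] [:: (j, false); (i, false)]
| artinA_braid (i j : 'I_n) : j = i.+1 :> nat ->
    artinArel [:: (i, false); (j, false); (i, false)]
              [:: (j, false); (i, false); (j, false)].

Definition artinA (n : nat) : groupType := presented (@artinArel n).

Definition generated_by (G : groupType) (s : seq G) (H : {pred G}) : Prop :=
  [/\ group_closed H, {subset s <= H} &
      forall K : {pred G}, group_closed K -> {subset s <= K} -> {subset H <= K}].

Definition finitely_generated (G : groupType) (H : {pred G}) : Prop :=
  exists s : seq G, generated_by s H.

(* A homomorphism from H to Z is represented by a map on G whose values outside
   of H are irrelevant. *)
Definition is_homZ (G : groupType) (H : {pred G}) (f : G -> int) : Prop :=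
  {in H &, forall x y, f (x * y) = (f x + f y)%R}.

Definition locally_indicable (G : groupType) : Prop :=
  forall H : {pred G}, group_closed H -> finitely_generated H ->
    (exists2 x, x \in H & x != 1) ->
    exists2 f : G -> int, is_homZ H f & exists2 x, x \in H & f x != 0%R.

(* Main.v *)
(* For n <= 3, A_(A_n) maps onto A_(A_(n-1)) (a_1, a_3 |-> a_1, a_2 |-> a_2 if
   n = 3, and a_1, a_2 |-> a_1 if n = 2) with a section, and the kernel is free of
   rank 2; freeness is seen on the action of A_(A_n) on the cosets of the section,
   where the kernel acts by left translations of a free group. Free groups are
   locally indicable because each nontrivial element acts nontrivially in some
   unitriangular representation, and local indicability passes to extensions.

   For n >= 4, put e_i = a_i for i <= 4 and let e_5 close this chain into a
   pentagon of half-twists. For a homomorphism f to Z defined on the subgroup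
   generated by the e_i e_1^-1, the braid relation between neighbours e_i, e_j and
   an e_k commuting with both give f(e_i e_k^-1) = f(e_j e_k^-1), so f = 0; the
   subgroup is nontrivial since a_1 and a_2 act differently as transpositions. *)

Require Import Defs.
From mathcomp Require Import all_boot all_order all_algebra.
From mathcomp Require Import boolp ring zify.

Set Implicit Arguments.
Unset Strict Implicit.
Unset Printing Implicit Defensive.

Import Order.TTheory GRing.Theory Num.Theory.

Local Open Scope group_scope.
Local Open Scope quotient_scope.

(** * Homomorphisms and criteria for local indicability *)

Lemma morph_one (G H : groupType) (f : G -> H) :
  {morph f : x y / x * y} -> f 1 = 1.
Proof. by move=> fM; apply: (mulgI (f 1)); rewrite -fM !mulg1. Qed.

Lemma morph_inv (G H : groupType) (f : G -> H) :
  {morph f : x y / x * y} -> {morph f : x / x^-1}.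
Proof.
by move=> fM x; apply: (mulgI (f x)); rewrite -fM !mulgV (morph_one fM).
Qed.

Section LocallyIndicable.
Variable G : groupType.
Implicit Types H : {pred G}.

(** The elements of [H] with property [P] form a subgroup containing [s], so the minimality of [H]
    applies. *)
Lemma generated_ind (s : seq G) H (P : G -> Prop) :
    generated_by s H -> {in s, forall x, P x} -> P 1 ->
    {in H &, forall x y, P x -> P y -> P (x / y)} ->
  {in H, forall x, P x}.
Proof.
move=> [[H1 HV] sH Hmin] Ps P1 PV x Hx.
suff /(_ x Hx) : {subset H <= [pred y | (y \in H) && `[< P y >]]}.
  by rewrite inE => /andP[_ /asboolP].
apply: Hmin => [|y sy]; last first.
  by rewrite inE sH //=; apply/asboolP/Ps.
split=> [|y z]; first by rewrite inE H1 /=; apply/asboolP.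
rewrite !inE => /andP[Hy /asboolP Py] /andP[Hz /asboolP Pz].
by rewrite HV //=; apply/asboolP/PV.
Qed.

(** The image [K] of [H] is finitely generated and nontrivial, and a map from [K] to Z composes with
    [r]. Multiplicativity is asked on [H] only, to allow maps that are homomorphisms just on a
    kernel. *)
Lemma locally_indicable_pullback (F : groupType) (r : G -> F) H :
    locally_indicable F -> group_closed H -> finitely_generated H ->
    {in H &, {morph r : x y / x * y}} -> (exists2 x, x \in H & r x != 1) ->
  exists2 f : G -> int, is_homZ H f & exists2 x, x \in H & f x != 0%R.
Proof.
move=> liF Hgr [s Hs] rM [x Hx rx].
have HM := group_closedM Hgr; have HV := group_closedV Hgr.
have r1 : r 1 = 1.
  by apply: (mulgI (r 1)); rewrite -rM ?mulg1 //; case: Hgr.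
have rV : {in H, {morph r : y / y^-1}}.
  by move=> y Hy; apply: (mulgI (r y)); rewrite -rM ?HV ?mulgV.
pose K : {pred F} := [pred z | `[< exists2 y, y \in H & r y = z >]].
have rK y : y \in H -> r y \in K by move=> Hy; rewrite inE; apply/asboolP; exists y.
have Kgr : group_closed K.
  split=> [|u v]; first by rewrite -r1; apply: rK; case: Hgr.
  rewrite !inE => /asboolP[y Hy <-] /asboolP[z Hz <-].
  by rewrite -rV // -rM ?HV //; apply: rK; rewrite HM ?HV.
have [||f fM [z]] := liF K Kgr.
- exists [seq r y | y <- s]; split=> // [_ /mapP[y sy ->]|L [L1 LV] sL u].
    by apply: rK; case: Hs => _ sH _; apply: sH.
  rewrite inE => /asboolP[y Hy <-]; move: y Hy.
  apply: (generated_ind Hs) => [y sy||y z Hy Hz Ly Lz].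
  + by apply: sL; apply: map_f.
  + by rewrite r1.
  + by rewrite rM ?HV // rV //; apply: LV.
- by exists (r x); [apply: rK|].
rewrite inE => /asboolP[y Hy <-] fy; exists (f \o r); last by exists y.
by move=> u v Hu Hv /=; rewrite rM // fM ?rK.
Qed.

(* The first coordinate moved by a subgroup is moved by translations. *)
Lemma locally_indicable_triangular :
    (forall x : G, x != 1 -> exists act : G -> (nat -> int) -> nat -> int,
      [/\ forall a b v, act (a * b) v = act a (act b v),
          forall a i v v', (forall j, j < i -> v j = v' j) ->
            (act a v i - v i = act a v' i - v' i)%R &
          exists v i, act x v i <> v i]) ->
  locally_indicable G.
Proof.
move=> res H _ _ [x Hx /res[act [actM tri [v0 [i0 mv0]]]]].
pose moved i := `[< exists2 h, h \in H & exists v, act h v i <> v i >].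
have exm : exists i, moved i by exists i0; apply/asboolP; exists x => //; exists v0.
have [i /asboolP[h Hh [v mv]] imin] := ex_minnP exm.
exists (fun a => act a v i - v i)%R; last first.
  by exists h => //; rewrite subr_eq0; apply/eqP.
(* By minimality of [i], [b] fixes the coordinates of [v] below [i], so [a] displaces coordinate [i]
   of [act b v] and of [v] by the same amount. *)
move=> a b Ha Hb /=; rewrite actM -(tri a i (act b v) v) ?addrA ?subrK //.
move=> j ji; apply: contrapT => nj.
suff : i <= j by rewrite leqNgt ji.
by apply: imin; apply/asboolP; exists b => //; exists v.
Qed.

(** Either [phi] is nontrivial on [H] and a map to Z comes from [Q], or [H] lies in the kernel,
    where [r] is an injective homomorphism. *)
Lemma locally_indicable_extension (F Q : groupType) (phi : G -> Q) (r : G -> F) :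
    {morph phi : x y / x * y} ->
    (forall x y, phi x = 1 -> phi y = 1 -> r (x * y) = r x * r y) ->
    (forall x, phi x = 1 -> r x = 1 -> x = 1) ->
  locally_indicable F -> locally_indicable Q -> locally_indicable G.
Proof.
move=> phiM rM inj liF liQ H Hgr Hfg [x Hx nx].
have [[y Hy py]|ker] := pselect (exists2 y, y \in H & phi y != 1).
  by apply: (locally_indicable_pullback (r := phi) liQ Hgr Hfg); [exact: in2W|exists y].
have pH y : y \in H -> phi y = 1.
  by move=> Hy; apply/eqP/negPn/negP => py; apply: ker; exists y.
apply: (locally_indicable_pullback (r := r) liF Hgr Hfg).
  by move=> y z Hy Hz; rewrite rM ?pH.
exists x => //; apply: contra_neq nx; apply: inj; exact: pH.
Qed.

End LocallyIndicable.

(** * Presented groups: actions and homomorphisms *)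

Definition gen (X : choiceType) (R : word X -> word X -> Prop) (x : X) : presented R :=
  \pi_(presented R) [:: (x, false)].

Section Presented.
Variables (X : choiceType) (R : word X -> word X -> Prop).
Local Notation G := (presented R).
Local Notation genR := (gen R).

Lemma piM u v : \pi_G u * \pi_G v = \pi_G (u ++ v).
Proof. exact: presMul_pi. Qed.

Lemma genV x : (genR x)^-1 = \pi_G [:: (x, true)].
Proof.
apply: mulg1_eq; rewrite piM.
by apply/pres_piP; apply: presEq_cancel.
Qed.

Lemma pres_ind (P : G -> Prop) :
    P 1 -> (forall x a, P a -> P (genR x * a)) ->
    (forall x a, P a -> P ((genR x)^-1 * a)) ->
  forall a, P a.
Proof.
move=> P1 Pg PV; elim/quotW; elim=> [|[x b] u IHu]; first exact: P1.
rewrite -[_ :: _]/([:: (x, b)] ++ u) -piM.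
by case: b; [rewrite -genV; apply: PV|apply: Pg].
Qed.

Section Action.
Variables (T : Type) (p q : X -> T -> T).

Definition letter_act (l : X * bool) : T -> T := if l.2 then q l.1 else p l.1.

Definition pres_act (a : G) (t : T) : T := foldr letter_act t (repr a).

Definition act_compat : Prop :=
  forall u v, R u v -> foldr letter_act ^~ u =1 foldr letter_act ^~ v.

Hypotheses (pK : forall x, cancel (p x) (q x)) (qK : forall x, cancel (q x) (p x)).
Hypothesis actR : act_compat.

Lemma pres_act_pi u t : pres_act (\pi_G u) t = foldr letter_act t u.
Proof.
have /asboolP : presEq R (repr (\pi_G u)) u := pres_reprP R u.
rewrite /pres_act; move: (repr _) => v /asboolP vu.
elim: vu t => {u v} [//|u v _ IH|v u w _ IH1 _ IH2|u u' v v' _ IH1 _ IH2|x b|u v uv] t.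
- by rewrite IH.
- by rewrite IH1.
- by rewrite !foldr_cat IH2 IH1.
- by case: b; rewrite /= /letter_act /= ?pK ?qK.
- exact: actR.
Qed.

Lemma pres_act1 t : pres_act 1 t = t.
Proof. exact: pres_act_pi. Qed.

Lemma pres_actM a b t : pres_act (a * b) t = pres_act a (pres_act b t).
Proof.
elim/quotW: a => u; elim/quotW: b => v.
by rewrite piM !pres_act_pi foldr_cat.
Qed.

Lemma pres_act_gen x t : pres_act (genR x) t = p x t.
Proof. exact: pres_act_pi. Qed.

Lemma pres_act_genV x t : pres_act (genR x)^-1 t = q x t.
Proof. by rewrite genV; apply: pres_act_pi. Qed.

End Action.

Section Hom.
Variables (G' : groupType) (h : X -> G').

(** The image of 1 under the action by left multiplications, so that only [act_compat] remains to be
    checked on the relations. *)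
Definition pres_hom (a : G) : G' :=
  pres_act (fun x => *%g (h x)) (fun x => *%g (h x)^-1) a 1.

Hypothesis homR : act_compat (fun x => *%g (h x)) (fun x => *%g (h x)^-1).

Let hK x : cancel ( *%g (h x)) ( *%g (h x)^-1).
Proof. exact: mulKg. Qed.

Let hVK x : cancel ( *%g (h x)^-1) ( *%g (h x)).
Proof. exact: mulVKg. Qed.

Lemma pres_homM : {morph pres_hom : a b / a * b}.
Proof.
move=> a b; rewrite /pres_hom pres_actM //.
(* [a] acts on every [c] as left multiplication by its own image. *)
set c := pres_act _ _ b 1; elim/pres_ind: a => [|x a IHa|x a IHa].
- by rewrite !pres_act1 // mul1g.
- by rewrite ![pres_act _ _ (_ * a) _]pres_actM // !pres_act_gen // IHa mulgA.
- by rewrite ![pres_act _ _ (_ * a) _]pres_actM // !pres_act_genV // IHa mulgA.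
Qed.

Lemma pres_hom_gen x : pres_hom (genR x) = h x.
Proof. by rewrite /pres_hom pres_act_gen // mulg1. Qed.

End Hom.

Lemma pres_hom_eq (G' : groupType) (f g : G -> G') :
    {morph f : x y / x * y} -> {morph g : x y / x * y} ->
    (forall x, f (genR x) = g (genR x)) ->
  f =1 g.
Proof.
move=> fM gM fg; elim/pres_ind => [|x a IHa|x a IHa].
- by rewrite !morph_one.
- by rewrite fM gM fg IHa.
- by rewrite fM gM !morph_inv // fg IHa.
Qed.

End Presented.

(* theta(F) is a normal complement of the image of sigma; G acts on the set of
   cosets of that image, which is identified with F through theta. *)
Lemma locally_indicable_split (X Y : choiceType) (R : word X -> word X -> Prop)
    (S : word Y -> word Y -> Prop) (G := presented R) (F := presented S)
    (Q : groupType) (p q : X -> F -> F)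
    (theta : F -> G) (sigma : Q -> G) (phi : G -> Q) :
    (forall x, cancel (p x) (q x)) -> (forall x, cancel (q x) (p x)) ->
    act_compat R p q ->
    {morph theta : x y / x * y} -> {morph sigma : x y / x * y} ->
    {morph phi : x y / x * y} ->
    (forall x w, gen R x * theta w = theta (p x w) * sigma (phi (gen R x))) ->
    (forall y f, pres_act p q (theta (gen S y)) f = gen S y * f) ->
  locally_indicable F -> locally_indicable Q -> locally_indicable G.
Proof.
move=> pK qK actR thM sgM phM step actg liF liQ.
have actth w f : pres_act p q (theta w) f = w * f.
  elim/pres_ind: w => [|y w IHw|y w IHw].
  - by rewrite (morph_one thM) pres_act1 // mul1g.
  - by rewrite thM pres_actM // IHw actg mulgA.
  - rewrite thM pres_actM // IHw (morph_inv thM) -{1}[w * f](mulVKg (gen S y)).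
    by rewrite -actg -pres_actM // mulVg pres_act1 // mulgA.
(* [rho a] is the coset of [a]: the image of the base coset under [a]. *)
pose rho (a : G) := pres_act p q a 1.
have rhoE a : a = theta (rho a) * sigma (phi a).
  rewrite /rho; elim/pres_ind: a => [|x a IHa|x a IHa].
  - by rewrite pres_act1 // (morph_one phM) (morph_one thM) (morph_one sgM) mulg1.
  - by rewrite phM pres_actM // pres_act_gen // sgM mulgA -step -mulgA -IHa.
  - rewrite phM pres_actM // pres_act_genV // sgM mulgA (morph_inv phM) (morph_inv sgM).
    rewrite {1}IHa.
    set w := pres_act _ _ a 1; rewrite -{1}[w](qK x) mulgA; congr (_ * _).
    by apply: (mulIg (sigma (phi (gen R x)))); rewrite mulgVK -mulgA -step mulKg.
(* On the kernel [rho] inverts [theta]; by [actth] it is multiplicative there. *)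
have kerE a : phi a = 1 -> a = theta (rho a).
  by move=> pa; rewrite {1}[a]rhoE pa (morph_one sgM) mulg1.
apply: (locally_indicable_extension (phi := phi) (r := rho)) => //.
  by move=> a b /kerE Ea _; rewrite {1}Ea /rho pres_actM // actth.
by move=> a /kerE Ea ra; rewrite Ea ra morph_one.
Qed.


(** * Free groups through unitriangular actions on integer sequences *)

Section Free.
Variables (X : choiceType) (R : word X -> word X -> Prop).
Hypothesis noR : forall u v, ~ R u v.
Local Notation G := (presented R).

Definition reduced (w : word X) : bool :=
  sorted (fun l l' => l' != (l.1, ~~ l.2)) w.

(** A letter put before a reduced word either keeps it reduced or cancels its head. *)
Lemma reducedP (a : G) : exists2 w, reduced w & a = \pi_G w.
Proof.
have ins x b w : reduced w ->
    exists2 w', reduced w' & \pi_G ((x, b) :: w) = \pi_G w'.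
  case: w => [|l w] rw; first by exists [:: (x, b)].
  have [lE|nl] := eqVneq l (x, ~~ b); last first.
    by exists [:: (x, b), l & w] => //; rewrite /reduced /= nl.
  exists w; first exact: path_sorted rw.
  apply/pres_piP; rewrite lE -[(_ :: _)]/([:: (x, b); (x, ~~ b)] ++ w).
  by apply: (@presEq_cat _ _ _ [::] w w); [apply: presEq_cancel|apply: presEq_refl].
elim/quotW: a; elim=> [|[x b] w [w' rw' Ew]]; first by exists [::].
have [w'' rw'' Ew'] := ins x b w' rw'; exists w'' => //; rewrite -Ew'.
by apply/pres_piP/(@presEq_cat _ _ [:: _] [:: _] w w'); [apply: presEq_refl|apply/pres_piP].
Qed.

(** Generators of the maximal blocks of letters on one generator, listed from right to left because
    the rightmost letters act first. *)
Fixpoint syllables (w : word X) : seq X :=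
  if w is l :: w' then
    if ohead w' is Some l' then
      if l'.1 == l.1 then syllables w' else rcons (syllables w') l.1
    else [:: l.1]
  else [::].

Lemma syllables_cons l w : exists s, syllables (l :: w) = rcons s l.1.
Proof.
elim: w l => [|l' w IHw] l; first by exists [::].
rewrite /=; case: eqP => [<-|_]; last by eexists.
by have [s /= ->] := IHw l'; exists s.
Qed.

Lemma syllables_sorted w : sorted (fun x y => x != y) (syllables w).
Proof.
elim: w => [|l [|l' w] IHw] //.
have -> : syllables [:: l, l' & w] =
  if l'.1 == l.1 then syllables (l' :: w) else rcons (syllables (l' :: w)) l.1 by [].
case: eqP => // /eqP nl; have [s Es] := syllables_cons l' w.
move: IHw; rewrite Es; case: s {Es} => [|y s] /=; first by rewrite nl.
by rewrite !rcons_path last_rcons nl => ->.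
Qed.

Section Shift.
Variable s : seq X.

Definition hit (x : X) (i : nat) : bool := (0 < i) && (onth s i.-1 == Some x).

(** The matrix I + N_x, or I - N_x if [b] is true, where N_x is the sum of the elementary matrices
    E_(i, i-1) over the [i] with [hit x i]. *)
Definition shift (b : bool) (x : X) (v : nat -> int) (i : nat) : int :=
  (v i + (-1) ^+ b * (hit x i)%:R * v i.-1)%R.

Lemma shift_triangular b x i (v v' : nat -> int) :
  (forall j, j < i -> v j = v' j) -> (shift b x v i - v i = shift b x v' i - v' i)%R.
Proof.
rewrite /shift /hit; case: i => [|i] vv' /=; first by rewrite !mulr0 !mul0r; ring.
by rewrite (vv' i) //; ring.
Qed.

Hypothesis sD : sorted (fun x y => x != y) s.

(** Neighbours in [s] differ. This gives N_x^2 = 0, so I + N_x and I - N_x are inverse to each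
    other. *)
Lemma hitS x i : hit x i.+1 -> ~~ hit x i.
Proof.
move=> /andP[_ /eqP si1]; apply/negP => /andP[i0 /eqP si].
have i1s : i < size s by rewrite -onthTE [onth s i]si1.
have := sortedP x sD i.-1; rewrite prednK // => /(_ i1s).
by rewrite (onth_nth x x _ _ si) (onth_nth x x _ _ (si1 : onth s i = _)) eqxx.
Qed.

Lemma shiftK b x : cancel (shift b x) (shift (~~ b) x).
Proof.
move=> v; apply/funext => -[|i]; rewrite /shift; first by rewrite /hit /=; ring.
have := @hitS x i; case: (hit x i.+1) => [/(_ isT)/negPf->|_] /=; last by ring.
by case: b => /=; ring.
Qed.

End Shift.

Definition word_act (s : seq X) : word X -> (nat -> int) -> nat -> int :=
  fun w v => foldr (letter_act (shift s false) (shift s true)) v w.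

Definition delta0 (i : nat) : int := ((i == 0)%N)%:R%R.

(* Applying a further letter of the last syllable increases the absolute value
   of the last coordinate; a new syllable moves the support by one. *)
Lemma reduced_act (w : word X) (t : seq X) (s := syllables w ++ t)
    (v := word_act s w delta0) (m := size (syllables w)) :
    reduced w -> sorted (fun x y => x != y) s ->
  [/\ (v m != 0)%R, (forall j, m < j -> v j = 0%R) &
      forall l, ohead w = Some l -> (0 < (-1) ^+ l.2 * v m * v m.-1)%R].
Proof.
(* The induction runs over suffixes of a word whose whole syllable list is fixed; [t] holds the
   syllables still to come. *)
rewrite {}/v {}/m {}/s; elim: w t => [|[x b] w IHw] t rw sD.
  by split=> // j; rewrite /delta0; case: j.
have {}rw' : reduced w := path_sorted rw.
set s := _ ++ t in sD *.
have actE : word_act s ((x, b) :: w) delta0 = shift s b x (word_act s w delta0).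
  by case: b @s {rw sD}.
have [u Eu] : exists u, syllables ((x, b) :: w) = rcons u x := syllables_cons _ w.
have sE : s = rcons u x ++ t by rewrite /s Eu.
clearbody s; have hitu : hit s x (size u).+1.
  by rewrite /hit sE /= onth_cat size_rcons leqnn onthE map_rcons nth_rcons size_map ltnn eqxx.
have hitu' := hitS sD hitu.
rewrite actE Eu size_rcons /=.
set v := word_act s w delta0.
have [pos v_gt] : (0 < (-1) ^+ b * (v (size u).+1 + (-1) ^+ b * v (size u)) * v (size u))%R
    /\ forall j, (size u).+1 < j -> v j = 0%R.
  (* If the letter opens a new syllable, coordinate [(size u).+1] of [v] is still 0 and [v (size u)]
     is nonzero. *)
  have new : syllables w = u -> (0 < (-1) ^+ b *
      (v (size u).+1 + (-1) ^+ b * v (size u)) * v (size u))%R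
      /\ forall j, (size u).+1 < j -> v j = 0%R.
    move=> Ew; have Es : s = syllables w ++ x :: t by rewrite sE Ew cat_rcons.
    have [] := IHw (x :: t) rw'; rewrite -Es // -/v Ew => nz v0 _.
    split=> [|j uj]; last by rewrite v0 // ltnW.
    by rewrite v0 //; case: (b); move: nz => /=; clear; nia.
  case: w => [|[y c] w] in rw rw' IHw actE Eu v new *.
    by apply: new; have /= := congr1 size Eu; rewrite size_rcons => -[/esym/size0nil].
  have [xy|nxy] := eqVneq y x; last first.
    by apply: new; move: Eu; rewrite /= (negPf nxy) => /rcons_inj[].
  have Ew : syllables ((y, c) :: w) = rcons u x by rewrite -Eu /= xy eqxx.
  (* Within a syllable of a reduced word all exponents agree, so the added term has the sign of
     [v (size u).+1] and nothing cancels. *)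
  have cb : c = b by move: rw; rewrite /reduced /= xy; case: (b); case: (c); rewrite ?eqxx.
  have Es : s = syllables ((y, c) :: w) ++ t by rewrite Ew.
  have [] := IHw t rw'; rewrite -Es // -/v Ew size_rcons /= => _ v0 /(_ _ erefl) /= vs.
  split=> [|j uj]; last exact: v0.
  by move: vs; rewrite cb; case: (b); clear; nia.
have -> : shift s b x v (size u) = v (size u).
  by rewrite /shift (negPf hitu') mulr0 mul0r addr0.
have -> : shift s b x v (size u).+1 = (v (size u).+1 + (-1) ^+ b * v (size u))%R.
  by rewrite /shift hitu mulr1.
split=> [|j uj|l [<-] //].
  by apply: contraTneq pos => ->; rewrite mulr0 mul0r ltxx.
(* Beyond [(size u).+1] only the next coordinate could become nonzero, and [hitS] excludes two
   adjacent hits. *)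
rewrite /shift v_gt // add0r; case: (ltngtP j.-1 (size u).+1) => [ju|ju|ju].
- by move: ju uj; clear; lia.
- by rewrite v_gt // mulr0.
suff /negPf-> : ~~ hit s x j by rewrite mulr0 mul0r.
have -> : j = (size u).+2 by move: ju uj; clear; lia.
by apply: contraL hitu; apply: hitS.
Qed.

Lemma free_locally_indicable : locally_indicable G.
Proof.
apply: locally_indicable_triangular => x nx.
have [w rw Ex] := reducedP x.
pose s := syllables w ++ [::].
have sD : sorted (fun x y => x != y) s by rewrite /s cats0; apply: syllables_sorted.
pose p := shift s false; pose q := shift s true.
have pK y : cancel (p y) (q y) := shiftK sD false y.
have qK y : cancel (q y) (p y) := shiftK sD true y.
have actR : act_compat R p q by move=> u v /noR.
exists (pres_act p q); split; first exact: pres_actM.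
  (* Unitriangularity survives composition with one more shift. *)
  have step b y (f : (nat -> int) -> nat -> int) :
      (forall i v v', (forall j, j < i -> v j = v' j) -> (f v i - v i = f v' i - v' i)%R) ->
      forall i v v', (forall j, j < i -> v j = v' j) ->
        (shift s b y (f v) i - v i = shift s b y (f v') i - v' i)%R.
    move=> IHf i v v' vv'; have fE j : j < i -> f v j = f v' j.
      move=> ji; have := IHf j v v'; rewrite (vv' j ji) => /(_ _)/addIr-> // k kj.
      exact/vv'/(ltn_trans kj).
    by have := shift_triangular s b y fE; have := IHf i v v' vv'; clear; lia.
  elim/pres_ind => [|y a IHa|y a IHa] i v v' vv'.
  - by rewrite !pres_act1 // !subrr.
  - by rewrite !pres_actM // !pres_act_gen //; apply: (step false y (pres_act p q a)).
  - by rewrite !pres_actM // !pres_act_genV //; apply: (step true y (pres_act p q a)).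
(* This index is positive, so [delta0] is 0 there while its image under [x] is not. *)
exists delta0, (size (syllables w)).
rewrite Ex pres_act_pi //; have [nz _ _] := reduced_act rw sD.
move: nz; rewrite /word_act -/s -/p -/q => /eqP.
have w0 : 0 < size (syllables w).
  case: (w) Ex => [/eqP|l u _]; first by rewrite (negPf nx).
  by have [u' ->] := syllables_cons l u; rewrite size_rcons.
by case: (size _) w0.
Qed.
End Free.

(** * Braid relations and maps out of Artin groups *)

Section Braid.
Variables (G : groupType) (a b : G).
Hypothesis ab : a * b * a = b * a * b.

Lemma braidJ : a * b * a^-1 = b^-1 * a * b.
Proof. by apply: (mulIg a); apply: (mulgI b); rewrite !mulgA mulgVK mulgV mul1g. Qed.

Lemma braidJV : a^-1 * b * a = b * a * b^-1.
Proof. by apply: (mulIg b); apply: (mulgI a); rewrite !mulgA mulgVK mulgV mul1g ab. Qed.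

End Braid.

Section Artin.
Variable n : nat.
Local Notation s := (gen (@artinArel n)).

Lemma artin_comm (i j : 'I_n) : (i.+2 <= j) || (j.+2 <= i) -> s i * s j = s j * s i.
Proof. by move=> ij; rewrite !piM; apply/pres_piP/presEq_rel/artinA_comm. Qed.

Lemma artin_braid (i j : 'I_n) :
  j = i.+1 :> nat -> s i * s j * s i = s j * s i * s j.
Proof.
move=> ij; rewrite [s i * s j]piM [s j * s i]piM !piM.
by apply/pres_piP/presEq_rel; apply: artinA_braid.
Qed.

Lemma artin_act_compat (T : Type) (p q : 'I_n -> T -> T) :
    (forall i j : 'I_n, i.+2 <= j -> p i \o p j =1 p j \o p i) ->
    (forall i j : 'I_n, j = i.+1 :> nat -> p i \o p j \o p i =1 p j \o p i \o p j) ->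
  act_compat (@artinArel n) p q.
Proof.
move=> pC pB u v [i j /orP[]|i j] ij t /=; first exact: pC.
  by symmetry; apply: pC.
exact: pB.
Qed.

Lemma artin_hom_compat (G : groupType) (h : 'I_n -> G) :
    (forall i j : 'I_n, i.+2 <= j -> h i * h j = h j * h i) ->
    (forall i j : 'I_n, j = i.+1 :> nat -> h i * h j * h i = h j * h i * h j) ->
  act_compat (@artinArel n) (fun i => *%g (h i)) (fun i => *%g (h i)^-1).
Proof.
move=> hC hB; apply: artin_act_compat => i j ij t /=; rewrite !mulgA.
  by rewrite hC.
by rewrite hB.
Qed.

End Artin.

(** * The cases n = 1, 2, 3 *)

(** With a single generator neither kind of relation has an instance, so the group is free. *)
Lemma artinA1_locally_indicable : locally_indicable (artinA 1).
Proof. by apply: free_locally_indicable => u v [] [[|i] hi] [[|j] hj]. Qed.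

Definition F2rel (u v : word bool) : Prop := False.
Local Notation F2 := (presented F2rel).
Local Notation gx := (gen F2rel false).
Local Notation gy := (gen F2rel true).

Lemma F2_locally_indicable : locally_indicable F2.
Proof. by apply: free_locally_indicable => u v []. Qed.

Section F2Hom.
Variable G : groupType.

Definition F2hom (a b : G) : F2 -> G := pres_hom (fun c => if c then b else a).

Lemma F2hom_compat a b :
  act_compat F2rel (fun c => *%g (if c then b else a))
    (fun c => *%g ((if c then b else a : G))^-1).
Proof. by move=> u v []. Qed.

Lemma F2homM a b : {morph F2hom a b : w z / w * z}.
Proof. exact: pres_homM (@F2hom_compat a b). Qed.

Lemma F2hom_x a b : F2hom a b gx = a.
Proof. exact: pres_hom_gen (@F2hom_compat a b) false. Qed.

Lemma F2hom_y a b : F2hom a b gy = b.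
Proof. exact: pres_hom_gen (@F2hom_compat a b) true. Qed.

Lemma F2homV a b : {morph F2hom a b : w / w^-1}.
Proof. exact: morph_inv (@F2homM a b). Qed.

Lemma F2hom_eq (f g : F2 -> G) :
    {morph f : w z / w * z} -> {morph g : w z / w * z} -> f gx = g gx -> f gy = g gy ->
  f =1 g.
Proof. by move=> fM gM fgx fgy; apply: pres_hom_eq => // -[]. Qed.

End F2Hom.

Definition F2homE := (F2homM, F2homV, F2hom_x, F2hom_y).

Lemma I2P (P : 'I_2 -> Prop) :
  P (@Ordinal 2 0 isT) -> P (@Ordinal 2 1 isT) -> forall i, P i.
Proof.
move=> P0 P1 [[|[|[]]] //= hi]; [move: P0|move: P1]; congr P; exact: val_inj.
Qed.

Lemma I3P (P : 'I_3 -> Prop) :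
    P (@Ordinal 3 0 isT) -> P (@Ordinal 3 1 isT) -> P (@Ordinal 3 2 isT) ->
  forall i, P i.
Proof.
move=> P0 P1 P2 [[|[|[|[]]]] //= hi]; [move: P0|move: P1|move: P2];
  congr P; exact: val_inj.
Qed.

(* artinA 2 acts on the left cosets of <a_1>: a_1 acts by conjugation, and a_2
   is the product of gx = a_2 a_1^-1 and a_1. *)
Lemma artinA2_locally_indicable : locally_indicable (artinA 2).
Proof.
pose a := gen (@artinArel 2) (@Ordinal 2 0 isT).
pose b := gen (@artinArel 2) (@Ordinal 2 1 isT).
have ab : a * b * a = b * a * b by apply: artin_braid.
pose c := gen (@artinArel 1) ord0.
(* [t] is conjugation by [a] on the kernel of [phi], in the generators gx = b a^-1 and gy = a gx
   a^-1; [t'] is its inverse. *)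
pose t : F2 -> F2 := F2hom gy (gx^-1 * gy).
pose t' : F2 -> F2 := F2hom (gx * gy^-1) gx.
have tK : cancel t t'.
  apply: (F2hom_eq (f := t' \o t) (g := id)) => //= [w z||]; rewrite /t /t' /= !F2homE //.
  by rewrite invgF mulgVK.
have t'K : cancel t' t.
  apply: (F2hom_eq (f := t \o t') (g := id)) => //= [w z||]; rewrite /t /t' /= !F2homE //.
  by rewrite invgM invgK mulVKg.
pose p (i : 'I_2) (w : F2) := if val i == 0 then t w else gx * t w.
pose q (i : 'I_2) (w : F2) := if val i == 0 then t' w else t' (gx^-1 * w).
have pK i : cancel (p i) (q i) by elim/I2P: i => w; rewrite /p /q /= ?mulKg tK.
have qK i : cancel (q i) (p i) by elim/I2P: i => w; rewrite /p /q /= t'K ?mulVKg.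
have pB : act_compat (@artinArel 2) p q.
  apply: artin_act_compat => i j; first by elim/I2P: i; elim/I2P: j.
  elim/I2P: i; elim/I2P: j => //= _ w; rewrite /p /= /t !F2homE !mulgA.
  by rewrite mulgV mul1g.
pose phi : artinA 2 -> artinA 1 := pres_hom (fun=> c).
have phC : act_compat (@artinArel 2) (fun=> *%g c) (fun=> *%g c^-1).
  by apply: artin_hom_compat.
pose sigma : artinA 1 -> artinA 2 := pres_hom (fun=> a).
have sgC : act_compat (@artinArel 1) (fun=> *%g a) (fun=> *%g a^-1).
  by apply: artin_hom_compat.
pose theta : F2 -> artinA 2 := F2hom (b * a^-1) (a * b * a^-1 * a^-1).
have thJ w : a * theta w = theta (t w) * a.
  apply: (mulIg a^-1); rewrite mulgK; move: w.
  apply: (F2hom_eq (f := fun w => a * theta w * a^-1) (g := theta \o t)) => /= [w z|w z||];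
    rewrite /theta /t /= ?F2homE //.
  - by rewrite !mulgA mulgVK.
  - by rewrite !mulgA.
  - by rewrite invgF {1}(braidJ ab) !mulgA.
have sgph i : sigma (phi (gen (@artinArel 2) i)) = a.
  by rewrite /phi pres_hom_gen // /sigma pres_hom_gen.
apply: (locally_indicable_split (p := p) (q := q) (theta := theta) (sigma := sigma)
         (phi := phi)) => //.
- exact: F2homM.
- exact: pres_homM sgC.
- exact: pres_homM phC.
- move=> i w; rewrite sgph; elim/I2P: i; first exact: thJ.
  by rewrite /p /= [theta (_ * _)]F2homM -mulgA -thJ F2hom_x mulgA mulgVK.
- have act0 f : pres_act p q a f = t f by rewrite pres_act_gen.
  have act1 f : pres_act p q b f = gx * t f by rewrite pres_act_gen.
  have act0V f : pres_act p q a^-1 f = t' f by rewrite pres_act_genV.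
  case=> f; rewrite /theta F2homE !pres_actM // !act0V ?act0 act1 !t'K //.
  have tM : {morph t : w z / w * z} := @F2homM _ _ _; by rewrite tM t'K /t F2hom_x.
- exact: F2_locally_indicable.
- exact: artinA1_locally_indicable.
Qed.

(* a_1 and a_2 act by automorphisms and a_3 = gx a_1, with gx = a_3 a_1^-1 acting
   by translation. *)
Lemma artinA3_locally_indicable : locally_indicable (artinA 3).
Proof.
pose s := gen (@artinArel 3).
pose a := s (@Ordinal 3 0 isT); pose b := s (@Ordinal 3 1 isT).
pose c := s (@Ordinal 3 2 isT).
have ab : a * b * a = b * a * b by apply: artin_braid.
have bc : b * c * b = c * b * c by apply: artin_braid.
have ac : a * c = c * a by apply: artin_comm.
pose a' := gen (@artinArel 2) (@Ordinal 2 0 isT).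
pose b' := gen (@artinArel 2) (@Ordinal 2 1 isT).
have ab' : a' * b' * a' = b' * a' * b' by apply: artin_braid.
(* [t1] and [t2] are conjugation by [a] and [b] on the kernel of [phi], in the generators gx = c
   a^-1, which commutes with [a], and gy = b gx b^-1. *)
pose t1 : F2 -> F2 := F2hom gx (gx^-1 * gy).
pose t1' : F2 -> F2 := F2hom gx (gx * gy).
pose t2 : F2 -> F2 := F2hom gy (gy * gx^-1 * gy).
pose t2' : F2 -> F2 := F2hom (gx * gy^-1 * gx) gx.
have t1M : {morph t1 : w z / w * z} := @F2homM _ _ _.
have t2M : {morph t2 : w z / w * z} := @F2homM _ _ _.
have t1K : cancel t1 t1'.
  apply: (F2hom_eq (f := t1' \o t1) (g := id)) => //= [w z||];
    rewrite /t1 /t1' /= !F2homE //.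
  by rewrite mulKg.
have t1'K : cancel t1' t1.
  apply: (F2hom_eq (f := t1 \o t1') (g := id)) => //= [w z||];
    rewrite /t1 /t1' /= !F2homE //.
  by rewrite mulVKg.
have t2K : cancel t2 t2'.
  apply: (F2hom_eq (f := t2' \o t2) (g := id)) => //= [w z||];
    rewrite /t2 /t2' /= !F2homE //.
  by rewrite !invgM !invgK !mulgA mulgV mul1g mulgVK.
have t2'K : cancel t2' t2.
  apply: (F2hom_eq (f := t2 \o t2') (g := id)) => //= [w z||];
    rewrite /t2 /t2' /= !F2homE //.
  by rewrite !invgM !invgK !mulgA mulgV mul1g mulgVK.
have t12 w : t1 (t2 (t1 w)) = t2 (t1 (t2 w)).
  move: w; apply: (F2hom_eq (f := t1 \o t2 \o t1) (g := t2 \o t1 \o t2)) => /=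
    [w z|w z||]; rewrite /t1 /t2 /= !F2homE //.
  - by rewrite !mulgA mulVg mul1g.
  - by rewrite !invgM !invgK -!mulgA !(mulKg, mulVKg).
pose p (i : 'I_3) (w : F2) : F2 := nth w [:: t1 w; t2 w; gx * t1 w] i.
pose q (i : 'I_3) (w : F2) : F2 := nth w [:: t1' w; t2' w; t1' (gx^-1 * w)] i.
have pK i : cancel (p i) (q i) by elim/I3P: i => w; rewrite /p /q /= ?mulKg ?t1K ?t2K.
have qK i : cancel (q i) (p i) by elim/I3P: i => w; rewrite /p /q /= ?t1'K ?t2'K ?mulVKg.
have pB : act_compat (@artinArel 3) p q.
  apply: artin_act_compat => i j; elim/I3P: i; elim/I3P: j => //= _ w; rewrite /p /=.
  - by rewrite t1M /t1 F2homE.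
  - by rewrite !t2M !t1M t12 /t1 /t2 !F2homE !mulgA mulgV mul1g.
pose h (i : 'I_3) : artinA 2 := nth 1 [:: a'; b'; a'] i.
pose phi : artinA 3 -> artinA 2 := pres_hom h.
have phC : act_compat (@artinArel 3) (fun i => *%g (h i)) (fun i => *%g (h i)^-1).
  by apply: artin_hom_compat => i j; elim/I3P: i; elim/I3P: j.
pose k (i : 'I_2) : artinA 3 := nth 1 [:: a; b] i.
pose sigma : artinA 2 -> artinA 3 := pres_hom k.
have sgC : act_compat (@artinArel 2) (fun i => *%g (k i)) (fun i => *%g (k i)^-1).
  by apply: artin_hom_compat => i j; elim/I2P: i; elim/I2P: j.
pose theta : F2 -> artinA 3 := F2hom (c * a^-1) (b * c * a^-1 * b^-1).
have thM : {morph theta : w z / w * z} := @F2homM _ _ _.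
(* The relations carry a tail [r] for rewriting inside right-associated products; [mulIg 1] below
   supplies the tail. *)
have abV r : a^-1 * (b^-1 * (a^-1 * r)) = b^-1 * (a^-1 * (b^-1 * r)).
  by rewrite !mulgA -!invgM !mulgA ab.
have bcJ r : b * (c * (b^-1 * r)) = c^-1 * (b * (c * r)).
  by rewrite !mulgA (braidJ bc).
have abJV r : a^-1 * (b^-1 * (a * r)) = b * (a^-1 * (b^-1 * r)).
  rewrite !mulgA; congr (_ * r); apply: invg_inj.
  by rewrite !invgM !invgK !mulgA (braidJV ab).
have acV r : a^-1 * (c * r) = c * (a^-1 * r).
  by apply: (mulgI a); rewrite mulVKg (mulgA a) ac -mulgA mulVKg.
have thJ1 w : a * theta w = theta (t1 w) * a.
  apply: (mulIg a^-1); rewrite mulgK; move: w.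
  apply: (F2hom_eq (f := fun w => a * theta w * a^-1) (g := theta \o t1)) => /= [w z|w z||];
    rewrite /theta /t1 /= ?F2homE //.
  - by rewrite !mulgA mulgVK.
  - by rewrite mulgA ac mulgK.
  - by apply: (mulIg 1); rewrite invgF -!mulgA abV bcJ.
have thJ2 w : b * theta w = theta (t2 w) * b.
  apply: (mulIg b^-1); rewrite mulgK; move: w.
  apply: (F2hom_eq (f := fun w => b * theta w * b^-1) (g := theta \o t2)) => /= [w z|w z||];
    rewrite /theta /t2 /= ?F2homE //.
  - by rewrite !mulgA mulgVK.
  - by rewrite !mulgA.
  - apply: (mulIg 1); rewrite invgF -!mulgA abJV -bcJ mulKg acV abV bcJ.
    by rewrite mulVKg.
have sg0 : sigma a' = a by rewrite /sigma pres_hom_gen.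
have sg1 : sigma b' = b by rewrite /sigma pres_hom_gen.
apply: (locally_indicable_split (p := p) (q := q) (theta := theta) (sigma := sigma)
         (phi := phi)) => //.
- exact: pres_homM sgC.
- exact: pres_homM phC.
- move=> i w; rewrite [phi _]pres_hom_gen //; elim/I3P: i; rewrite /p /= ?sg0 ?sg1.
  + exact: thJ1.
  + exact: thJ2.
  + by rewrite thM -mulgA -thJ1 [theta gx]F2hom_x mulgA mulgVK.
- have act0V f : pres_act p q a^-1 f = t1' f by rewrite pres_act_genV.
  have act1 f : pres_act p q b f = t2 f by rewrite pres_act_gen.
  have act1V f : pres_act p q b^-1 f = t2' f by rewrite pres_act_genV.
  have act2 f : pres_act p q c f = gx * t1 f by rewrite pres_act_gen.
  case=> f; rewrite /theta F2homE !pres_actM // ?act1V act0V act2 t1'K //.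
  by rewrite act1 t2M t2'K /t2 F2hom_x.
- exact: F2_locally_indicable.
- exact: artinA2_locally_indicable.
Qed.

(** * Homomorphisms to Z and the pentagon of half-twists *)

(** As [c] commutes with [a] and [b], the elements u = a c^-1 and v = b c^-1 inherit the braid
    relation, both sides gaining c^-3. In Z it reads 2 f(u) + f(v) = 2 f(v) + f(u). *)
Lemma homZ_braid (G : groupType) (H : {pred G}) (f : G -> int) (a b c : G) :
    group_closed H -> is_homZ H f -> a * b * a = b * a * b ->
    a * c = c * a -> b * c = c * b -> a / c \in H -> b / c \in H ->
  f (a / c) = f (b / c).
Proof.
move=> Hgr fM ab ac bc Ha Hb; have HM := group_closedM Hgr.
have split (u v : G) : u * c = c * u -> v * c = c * v ->
    u / c * (v / c) * (u / c) = u * v * u * (c^-1 * c^-1 * c^-1).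
  have cR w r : w * c = c * w -> c^-1 * (w * r) = w * (c^-1 * r).
    by move=> wc; apply: (mulgI c); rewrite mulVKg (mulgA c) -wc -mulgA mulVKg.
  by move=> uc vc; rewrite -!mulgA (cR v) // !(cR u).
have := split a b ac bc; rewrite ab -split // => E.
have := congr1 f E; rewrite (fM _ _ (HM _ _ Ha Hb) Ha) (fM _ _ (HM _ _ Hb Ha) Hb).
by rewrite (fM _ _ Ha Hb) (fM _ _ Hb Ha); clear; lia.
Qed.

Section Pentagon.
Variables (G : groupType) (a b c d : G).
Hypotheses (ab : a * b * a = b * a * b) (bc : b * c * b = c * b * c)
  (cd : c * d * c = d * c * d) (ac : a * c = c * a) (ad : a * d = d * a)
  (bd : b * d = d * b).

(* The half-twist closing the chain a, b, c, d into a pentagon in which adjacent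
   elements satisfy the braid relation and the others commute. *)
Definition closing_twist : G := a ^ (d * c * b)^-1.
Local Notation e := closing_twist.

(** Here v = k u k^-1, so the commutation of [u] and [a] is conjugated by [k]. It serves for k = d c
    b, which carries [c] to [b] and [d] to [c]. *)
Let commuteJ (k u v : G) : k * u = v * k -> u * a = a * u ->
  v * a ^ k^-1 = a ^ k^-1 * v.
Proof.
move=> kuv ua; rewrite conjgE invgK !mulgA -kuv -(mulgA k) ua.
by apply: (mulIg k); rewrite mulgVK -[RHS]mulgA -kuv !mulgA mulgVK.
Qed.

Lemma closing_twist_b : b * e = e * b.
Proof.
apply: (@commuteJ _ c); last by rewrite ac.
by rewrite -!mulgA [c * (b * c)]mulgA -bc !mulgA bd.
Qed.

Lemma closing_twist_c : c * e = e * c.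
Proof.
apply: (@commuteJ _ d); last by rewrite ad.
by rewrite -!mulgA bd !mulgA cd.
Qed.

(** As d c commutes with [a], conjugation by d c carries b a b^-1 to [e] and fixes [a]. Moreover b a
    b^-1 = a^-1 b a, so this pair arises from [b] and [a] by conjugation with [a]. *)
Lemma closing_twist_a : e * a * e = a * e * a.
Proof.
have -> : e = (a ^ b^-1) ^ (d * c)^-1 by rewrite -conjgM -invgM.
have aJ : a ^ (d * c)^-1 = a.
  by rewrite conjgE invgK !mulgA -(mulgA d) -ac !mulgA -ad -(mulgA a d) mulgK.
rewrite -{2 4 6}aJ -!conjMg; congr (_ ^ _).
have -> : a ^ b^-1 = a^-1 * b * a by rewrite conjgE invgK mulgA (braidJV ab).
by apply: (mulgI a); rewrite -!mulgA !mulVKg !mulgA -ab.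
Qed.

(** From f(a/a) = 0, [homZ_braid] spreads 0 along the edges ab, bc, cd and ea, using the vertices d,
    e, a and c respectively, which commute with both ends. *)
Lemma pentagon_homZ (H : {pred G}) (f : G -> int) :
    group_closed H -> is_homZ H f ->
    {in [:: b; c; d; e], forall z, z / a \in H} ->
  {in [:: b; c; d; e], forall z, f (z / a) = 0%R}.
Proof.
move=> Hgr fM Hz; have [H1 HV] := Hgr.
have f1 : f (a / a) = 0%R.
  by rewrite mulgV; have := fM 1 1 H1 H1; rewrite mulg1; clear; lia.
have Ha : a / a \in H by rewrite mulgV.
have Hb : b / a \in H by apply: Hz; rewrite !inE eqxx.
have Hc : c / a \in H by apply: Hz; rewrite !inE eqxx ?orbT.
have Hd : d / a \in H by apply: Hz; rewrite !inE eqxx ?orbT.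
have He : e / a \in H by apply: Hz; rewrite !inE eqxx ?orbT.
have divH u v : u / a \in H -> v / a \in H -> u / v \in H.
  by move=> Hu Hv; rewrite -(@mulgKA _ a^-1 u v); apply: HV.
have split u v : u / a \in H -> v / a \in H -> f (u / v) = (f (u / a)%g - f (v / a)%g)%R.
  move=> Hu Hv; have := fM (u / v) (v / a) (divH _ _ Hu Hv) Hv.
  by rewrite divgKA => ->; rewrite addrK.
have eq u v w : u * v * u = v * u * v -> u * w = w * u -> v * w = w * v ->
    u / a \in H -> v / a \in H -> w / a \in H -> f (u / a) = f (v / a).
  move=> uv uw vw Hu Hv Hw.
  have := homZ_braid Hgr fM uv uw vw (divH _ _ Hu Hw) (divH _ _ Hv Hw).
  by rewrite (split u w) // (split v w) //; clear; lia.
have fb : f (b / a) = 0%R by rewrite -f1; symmetry; apply: (eq _ _ d).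
have fc : f (c / a) = 0%R by rewrite -fb; symmetry; apply: (eq _ _ e) => //;
  [exact: closing_twist_b|exact: closing_twist_c].
have fd : f (d / a) = 0%R by rewrite -fc; symmetry; apply: (eq _ _ a).
have fe : f (e / a) = 0%R.
  rewrite -f1; apply: (eq _ _ c) => //; first exact: closing_twist_a.
  by symmetry; apply: closing_twist_c.
by move=> z; rewrite !inE => /or4P[] /eqP->.
Qed.

End Pentagon.

(** * The action by transpositions *)

(** Acting on [nat] rather than on n + 1 points avoids carrying bounds. *)
Definition swap (i k : nat) : nat :=
  if k == i then i.+1 else if k == i.+1 then i else k.

Lemma swapL i : swap i i = i.+1.
Proof. by rewrite /swap eqxx. Qed.

Lemma swapR i : swap i i.+1 = i.
Proof. by rewrite /swap eqxx gtn_eqF. Qed.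

Lemma swapD i k : k != i -> k != i.+1 -> swap i k = k.
Proof. by rewrite /swap => /negPf-> /negPf->. Qed.

Lemma swapK i : involutive (swap i).
Proof.
move=> k; have [->|ki] := eqVneq k i; first by rewrite swapL swapR.
have [->|ki1] := eqVneq k i.+1; first by rewrite swapR swapL.
by rewrite !swapD.
Qed.

Lemma swap_comm i j : i.+2 <= j -> swap i \o swap j =1 swap j \o swap i.
Proof.
move=> ij k /=; have [->|ki] := eqVneq k i.
  by rewrite swapL !(@swapD j) ?swapL //; lia.
have [->|ki1] := eqVneq k i.+1; first by rewrite swapR !(@swapD j) ?swapR //; lia.
by rewrite (@swapD i k) //; apply: swapD;
  rewrite /swap; case: (k =P j) => _; try case: (k =P j.+1) => _; lia.
Qed.

Lemma swap_braid i : swap i \o swap i.+1 \o swap i =1 swap i.+1 \o swap i \o swap i.+1.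
Proof.
move=> k /=; have [->|ki] := eqVneq k i.
  by rewrite swapL swapL (@swapD i.+1 i) ?swapL ?(@swapD i i.+2) //; lia.
have [->|ki1] := eqVneq k i.+1.
  by rewrite swapR swapL (@swapD i.+1 i) ?(@swapD i i.+2) ?swapL ?swapR //; lia.
have [->|ki2] := eqVneq k i.+2.
  by rewrite swapR (@swapD i i.+2) ?swapR ?(@swapD i.+1 i) //; lia.
by rewrite !(@swapD i k, @swapD i.+1 k).
Qed.

Lemma swap_compat n :
  act_compat (@artinArel n) (fun i => swap i) (fun i => swap i).
Proof.
apply: artin_act_compat => i j ij; first exact: swap_comm.
by rewrite ij; apply: swap_braid.
Qed.

(** * The case n >= 4 *)

(** Encoded as the intersection of all subgroups containing [s], which makes minimality
    immediate. *)
Definition subgroup_generated (G : groupType) (s : seq G) : {pred G} :=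
  fun z => `[< forall K : {pred G}, group_closed K -> {subset s <= K} -> z \in K >].

Lemma subgroup_generatedP (G : groupType) (s : seq G) :
  generated_by s (subgroup_generated s).
Proof.
have inP z : (z \in subgroup_generated s) =
  `[< forall K : {pred G}, group_closed K -> {subset s <= K} -> z \in K >] by [].
split=> [|z sz|K Kgr sK z]; last by rewrite inP => /asboolP; apply.
  split=> [|u v]; rewrite ?inP.
    by apply/asboolP => K [].
  move=> /asboolP Hu /asboolP Hv; apply/asboolP => K Kgr sK.
  by case: (Kgr) => _; apply; [apply: Hu|apply: Hv].
by rewrite inP; apply/asboolP => K _; apply.
Qed.

Lemma artinA_not_locally_indicable n : 4 <= n -> ~ locally_indicable (artinA n).
Proof.
move=> n4 li; pose s := gen (@artinArel n).
pose a := s (Ordinal (ltn_trans (isT : 0 < 3) n4)).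
pose b := s (Ordinal (ltn_trans (isT : 1 < 3) n4)).
pose c := s (Ordinal (ltn_trans (isT : 2 < 3) n4)).
pose d := s (Ordinal n4).
pose gs := [seq z / a | z <- [:: b; c; d; closing_twist a b c d]].
have gsP := subgroup_generatedP gs; have [Hgr Hgs _] := gsP.
have ba : b / a \in gs by rewrite inE eqxx.
have [||f fM [z Hz]] := li (subgroup_generated gs) Hgr; first by exists gs.
  exists (b / a); first exact: Hgs.
  apply/eqP => /divg1_eq Eba.
  (* [a] sends 0 to 1, while [b] fixes 0. *)
  pose p (i : 'I_n) := swap i.
  have pE i : pres_act p p (s i) 0 = swap i 0.
    apply: pres_act_gen => [j|j|]; [exact: swapK|exact: swapK|exact: swap_compat].
  by have := pE (Ordinal (ltn_trans (isT : 1 < 3) n4)); rewrite -/b Eba pE.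
apply/negP; rewrite negbK; apply/eqP; move: z Hz.
have f0 : {in gs, forall z, f z = 0%R}.
  move=> _ /mapP[z zs ->].
  apply: (pentagon_homZ (a := a) (b := b) (c := c) (d := d) _ _ _ _ _ _ Hgr fM _ zs).
  - by apply: artin_braid.
  - by apply: artin_braid.
  - by apply: artin_braid.
  - by apply: artin_comm.
  - by apply: artin_comm.
  - by apply: artin_comm.
  - by move=> u us; apply/Hgs/mapP; exists u.
have [H1 HV] := Hgr; have f1 : f 1 = 0%R.
  by have := fM 1 1 H1 H1; rewrite mulg1; clear; lia.
apply: (generated_ind gsP) => // u v Hu Hv fu fv.
have := fM (u / v) v (HV _ _ Hu Hv) Hv.
by rewrite mulgVK fu fv addr0.
Qed.
Local Close Scope group_scope.

Theorem theorem4p6 (n : nat) (hn : 1 <= n) :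
  locally_indicable (artinA n) <-> n = 1 \/ n = 2 \/ n = 3.
Proof.
split=> [li|[->|[->|->]]]; last 3 first.
- exact: artinA1_locally_indicable.
- exact: artinA2_locally_indicable.
- exact: artinA3_locally_indicable.
case: (leqP 4 n) => [/artinA_not_locally_indicable //|].
by move: hn; clear; lia.
Qed.
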